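(* Consider the inviscid, unforced tree dyadic system ($f=\nu=0$) with $c_j=2^{\alpha|j|}$, $\alpha>0$, on a tree in which every node has exactly $N_*=2^{2\tilde\alpha}$ children, and suppose $\tilde\alpha<\alpha$. Let $X$ be any positive $l^2$ solution with initial condition $X^0$. Then there exists $C>0$, depending only on $\|X^0\|$ (for the fixed system parameters $\alpha$, $N_*$), such that for all $t>0$ $$\mathcal{E}(t):=\|X(t)\|^2:=\sum_{j\in J}X_j^2(t)<\frac{C}{t^2}.$$
   Context: $J$ is the set of nodes of an infinite rooted tree with root $0$. Each $j\in J$ has a generation $|j|\in\mathbb{N}$ with $|0|=0$, a set of children $\mathcal{O}_j\subset J$ with $|k|=|j|+1$ for $k\in\mathcal{O}_j$, and each $j\neq 0$ has a unique parent $\bar\jmath$ (so $j\in\mathcal{O}_{\bar\jmath}$). Every node has the same number $N_*\ge 1$ of children, and $\tilde\alpha:=\frac12\log_2 N_*$. The inviscid unforced tree dyadic system is $$\frac{d}{dt}X_j=c_jX_{\bar\jmath}^2-\sum_{k\in\mathcal{O}_j}c_kX_jX_k,\qquad j\in J,$$ with the convention $X_{\bar 0}\equiv 0$ for the (symbolic) parent $\bar 0$ of the root, and $c_j=2^{\alpha|j|}$, $\alpha>0$. A componentwise solution with initial condition $X^0\in\mathbb{R}^J$ is a family $X=(X_j)_{j\in J}$ of continuously differentiable functions $X_j:[0,\infty)\to\mathbb{R}$ with $X(0)=X^0$ satisfying all the equations. It is an $l^2$ solution if $X(t)\in l^2=l^2(J;\mathbb{R})$ for all $t\ge0$, and positive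 if $X_j(t)\ge0$ for all $j\in J$, $t\ge0$. $\|\cdot\|$ is the $l^2(J;\mathbb{R})$ norm. *)

(* Defs.v *)
From HB Require Import structures.
From mathcomp Require Import all_boot all_order all_algebra finmap.
From mathcomp Require Import all_classical all_reals all_analysis.

Set Implicit Arguments.
Unset Strict Implicit.
Unset Printing Implicit Defensive.

Import Order.TTheory GRing.Theory Num.Theory.
Import numFieldNormedType.Exports.

Local Open Scope classical_set_scope.
Local Open Scope ring_scope.

(** [treeP] makes the parent unique; it also forces [parent root = None],
    since no child has generation 0. *)
Record rooted_tree (J : choiceType) := RootedTree {
  root : J ;
  gen : J -> nat ;
  children : J -> {fset J} ;
  parent : J -> option J ;
  gen_root : gen root = 0%N ;
  gen_children : forall j k, k \in children j -> gen k = (gen j).+1 ;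
  treeP : forall j k, parent k = Some j <-> k \in children j ;
  parent_neq_root : forall k, k != root -> parent k != None
}.

Definition regular_tree (J : choiceType) (T : rooted_tree J) (N : nat) : Prop :=
  forall j, #|` children T j| = N.

Section TreeDyadic.
Variable R : realType.

Definition log2 (x : R) : R := ln x / ln 2.

Definition alpha_tilde (N : nat) : R := 2^-1 * log2 N%:R.

(** Derivative relative to a set, so that it is one-sided at an endpoint of
    [D]; the values of [f] outside [D] play no role when [t] is in [D]. *)
Definition has_derivative_in (D : set R) (f : R -> R) (t d : R) : Prop :=
  (f s - f t) / (s - t) @[s --> within D t^'] --> d.

Definition C1_in (D : set R) (f df : R -> R) : Prop :=
  {within D, continuous df} /\ forall t : R, D t -> has_derivative_in D f t (df t).

Section System.
Variables (J : choiceType) (T : rooted_tree J) (alpha : R).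

Definition coef (j : J) : R := 2 `^ (alpha * (gen T j)%:R).

(** The default value 0 of [oapp] is the convention that the symbolic parent
    of the root carries the zero function. *)
Definition dyadic_rhs (x : J -> R) (j : J) : R :=
  coef j * (oapp x 0 (parent T j)) ^+ 2
  - \sum_(k <- children T j) coef k * x j * x k.

(** A function on [0, +oo) is represented by one on [R] whose values at
    negative times are ignored. *)
Definition componentwise_solution (X0 : J -> R) (X : J -> R -> R) : Prop :=
  (forall j, X j 0 = X0 j) /\
  (forall j, exists2 dX : R -> R, C1_in `[0, +oo[ (X j) dX &
     forall t : R, 0 <= t -> dX t = dyadic_rhs (X ^~ t) j).

End System.

Section Norm.
Variable J : choiceType.

Definition sqnorm (x : J -> R) : \bar R := \esum_(j in [set: J]) (x j ^+ 2)%:E.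

Definition in_l2 (x : J -> R) : Prop := (sqnorm x < +oo)%E.

(** Meaningful only for [x] in l2: [fine] sends an infinite sum to 0. *)
Definition l2norm (x : J -> R) : R := Num.sqrt (fine (sqnorm x)).

Definition energy (X : J -> R -> R) (t : R) : \bar R := sqnorm (X ^~ t).

Definition l2_solution (T : rooted_tree J) (alpha : R)
    (X0 : J -> R) (X : J -> R -> R) : Prop :=
  componentwise_solution T alpha X0 X /\ forall t : R, 0 <= t -> in_l2 (X ^~ t).

Definition positive (X : J -> R -> R) : Prop :=
  forall (j : J) (t : R), 0 <= t -> 0 <= X j t.

End Norm.
End TreeDyadic.

(* Main.v *)
(** Write [b = 2^alpha], [a = sqrt N < b], [q = sqrt (a / b) < 1], and let [Y_n],
    [S_n] be the sums of [X_j], [X_j^2] over generation [n].  Summing the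
    equations over generation [n + 1] gives
    [Y_(n+1)' = N b^(n+1) S_n - b^(n+2) P_(n+1)] with [P] the sum of the products
    [X_j X_k] over parent-child pairs, while [e_m = S_0 + ... + S_(m-1)] satisfies
    [e_(m+1)' = - 2 b^(m+1) Q_m] with [Q] the sum of the [X_j^2 X_k].  By AM-GM, [P] is
    controlled by [Q], i.e. by the dissipation of [e], and by [Y], and
    [Y_n <= a^n sqrt E] by Cauchy-Schwarz.  Hence every [S_n] is bounded by the
    derivative of [Y_(n+1) / (N b^(n+1)) - (b mu / 4N) q^n e_(n+2)] plus an error
    [O(q^n)]; summing over [n] and integrating from [s] to [t] yields
    [(t - s) E(t) <= K (F + mu F^2 + (t - s) F / mu)] whenever [E(s) <= F^2] and
    [mu > 0].  With [s = t / 2] and [mu] a small multiple of [t], the bound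
    [E <= D^2 / t^2] at time [t / 2] reproduces itself at time [t] once [D] is
    large enough, so it propagates from [0 < t <= 1] to all times by doubling. *)

Require Import Defs.
From HB Require Import structures.
From mathcomp Require Import all_boot all_order all_algebra finmap.
From mathcomp Require Import all_classical all_reals all_analysis.
From mathcomp Require Import ring lra.

Set Implicit Arguments.
Unset Strict Implicit.

Import Order.TTheory GRing.Theory Num.Theory.
Import numFieldNormedType.Exports.

Local Open Scope classical_set_scope.
Local Open Scope ring_scope.

(** * Enumeration of the tree by generations *)

(** The map [g] recovers the block index from any entry, so distinct blocks are disjoint. It is
    instantiated with [parent] for the children lists and with [gen] for the levels. *)
Lemma uniq_flatten_map (S U : eqType) (f : S -> seq U) (g : U -> option S)
    (s : seq S) :
  uniq s -> (forall x, uniq (f x)) -> (forall x y, y \in f x -> g y = Some x) ->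
  uniq (flatten [seq f x | x <- s]).
Proof.
move=> us uf gf; elim: s us => //= x s IH /andP[xs us].
rewrite cat_uniq uf (IH us) andbT /=; apply/hasPn => y /flattenP[_ /mapP[z zs ->]].
move=> /gf gz; apply/negP => /gf; rewrite gz => -[zx].
by rewrite -zx zs in xs.
Qed.

Section Levels.
Variables (J : choiceType) (T : rooted_tree J).

Fixpoint level (n : nat) : seq J :=
  if n is m.+1 then flatten [seq enum_fset (children T j) | j <- level m]
  else [:: Defs.root T].

Lemma big_levelS (R : nmodType) (f : J -> R) n :
  \sum_(k <- level n.+1) f k =
  \sum_(j <- level n) \sum_(k <- children T j) f k.
Proof. by rewrite big_flatten big_map. Qed.

Lemma gen_level n j : j \in level n -> gen T j = n.
Proof.
elim: n j => [|n IH] j /=; first by rewrite inE => /eqP ->; exact: gen_root.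
move=> /flattenP[_ /mapP[i /IH <- ->]] ji; exact: gen_children.
Qed.

Lemma mem_level j : j \in level (gen T j).
Proof.
move: {2}(gen T j) (erefl (gen T j)) => n; elim: n j => [|n IH] j genj.
  (* A node other than the root has a parent, so its generation is a successor; generation 0
     therefore contains only the root. *)
  rewrite genj inE; apply: contraPT genj => /(@parent_neq_root _ T).
  by case E: parent => [i|//] _; rewrite (gen_children ((treeP T i j).1 E)).
have : j != Defs.root T by apply/eqP => jr; rewrite jr gen_root in genj.
move=> /(@parent_neq_root _ T); case E: parent => [i|//] _.
have ji := (treeP T i j).1 E.
move: (gen_children ji) genj => -> [genj] /=.
apply/flattenP; exists (enum_fset (children T i)) => //.
by apply/mapP; exists i => //; apply: IH.
Qed.

Lemma uniq_level n : uniq (level n).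
Proof.
elim: n => //= n IH; apply: (@uniq_flatten_map _ _ _ (parent T)) => // i j ji.
exact/treeP.
Qed.

Lemma size_level N n : regular_tree T N -> size (level n) = (N ^ n)%N.
Proof.
move=> TN; elim: n => //= n IH.
rewrite size_flatten /shape -map_comp sumnE big_map.
under eq_bigr => i _ do rewrite /= TN.
by rewrite big_const_seq count_predT iter_addn_0 IH expnSr mulnC.
Qed.

End Levels.


(** * The squared norm as a supremum of sums over generations *)

Section LevelSums.
Variables (R : realType) (J : choiceType) (T : rooted_tree J).

Definition nodes_below (n : nat) : seq J :=
  flatten [seq level T i | i <- iota 0 n].

Lemma uniq_nodes_below n : uniq (nodes_below n).
Proof.
apply: (@uniq_flatten_map _ _ _ (fun j => Some (gen T j))).
- exact: iota_uniq.
- exact: uniq_level.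
- by move=> i j /gen_level ->.
Qed.

Lemma mem_nodes_below n j : (j \in nodes_below n) = (gen T j < n)%N.
Proof.
apply/flattenP/idP => [[_ /mapP[i + ->] /gen_level ->]|jn].
  by rewrite mem_iota.
exists (level T (gen T j)); last exact: mem_level.
by apply: map_f; rewrite mem_iota.
Qed.

Lemma big_nodes_below (f : J -> R) n :
  \sum_(j <- nodes_below n) f j = \sum_(i < n) \sum_(j <- level T i) f j.
Proof.
rewrite big_flatten big_map -(big_mkord predT (fun i => \sum_(j <- level T i) f j)).
by rewrite /index_iota subn0.
Qed.

(** Every finite set of nodes has bounded generation, hence lies in some [nodes_below n]. Since the
    terms are nonnegative, these finite sets suffice to compute the supremum defining [esum]. *)
Lemma sqnorm_leP (x : J -> R) (B : R) :
  (sqnorm x <= B%:E)%E <->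
  (forall n, \sum_(i < n) \sum_(j <- level T i) x j ^+ 2 <= B).
Proof.
split=> [xB n|xB].
  rewrite -lee_fin; apply: le_trans xB; apply: esum_ge.
  exists [set` nodes_below n] => //.
  by rewrite -fsbig_seq ?uniq_nodes_below// sumEFin big_nodes_below.
apply: ge_ereal_sup => /= _ [A [finA _] <-].
pose n := (\max_(j <- fset_set A) (gen T j).+1)%N.
have nB : (\sum_(j <- nodes_below n) (x j ^+ 2)%:E <= B%:E)%E.
  by rewrite sumEFin lee_fin big_nodes_below.
apply: le_trans nB; rewrite [leRHS]fsbig_seq ?uniq_nodes_below//.
apply: (@lee_fsum_nneg_subset R J A [set` nodes_below n]) => //.
  move=> j; rewrite !inE /= mem_nodes_below => jA.
  by rewrite /n (big_rem j) ?in_fset_set ?inE//= leq_max leqnn.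
by move=> j _; rewrite lee_fin sqr_ge0.
Qed.

End LevelSums.

(** * Derivatives relative to a set and the mean value inequality *)

Section Calculus.
Variable R : realType.
Implicit Types (D : set R) (f : R -> R).

(** Near [t] the difference quotient is within 1 of [d], so [f] is Lipschitz at [t] with constant
    [|d| + 1]. This also covers the endpoint 0 of the time interval. *)
Lemma has_derivative_in_continuous D f t d :
  has_derivative_in D f t d -> f s @[s --> within D (nbhs t)] --> f t.
Proof.
move=> /cvgrPdist_lt /(_ 1 ltr01) quot.
apply/cvgrPdist_lt => e e0.
have d1 : 0 < `|d| + 1 by rewrite ltr_wpDl.
have : \forall s \near t, `|t - s| < e / (`|d| + 1).
  by apply: nbhsx_ballx; rewrite divr_gt0.
have {quot} : \forall s \near t, s != t -> D s ->
  `|d - (f s - f t) / (s - t)| < 1.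
  by move: quot; rewrite /prop_near1 /within /dnbhs /=; apply.
rewrite /prop_near1 /within /=.
apply: filterS2 => s quot se Ds.
have [->|st] := eqVneq s t; first by rewrite subrr normr0.
have st0 : s - t != 0 by rewrite subr_eq0.
rewrite -normrN opprB -[f s - f t](divfK st0) normrM distrC in se *.
rewrite distrC ltr_pdivlMr // mulrC in se *.
apply: le_lt_trans se; rewrite ler_wpM2r //.
have := ler_normB d (d - (f s - f t) / (s - t)).
by rewrite subKr => /le_trans; apply; rewrite lerD2l ltW // quot.
Qed.

Lemma has_derivative_in_is_derive D f t d :
  nbhs t D -> has_derivative_in D f t d -> is_derive t 1 f d.
Proof.
move=> Dt fd.
have : (f s - f t) / (s - t) @[s --> t^'] --> d.
  apply: cvg_trans fd; apply: cvg_app => P.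
  rewrite /within /dnbhs /= => Pt.
  by apply: filterS2 Dt Pt => s Ds Ps st; exact: Ps.
move=> ft.
have shift0 : h + t @[h --> 0^'] --> t^'.
  move=> P; rewrite /dnbhs /within /= => Pt.
  have := (nbhs0P (fun s : R => s != t -> P s) t).1 Pt.
  by apply: filterS => h /= + h0; rewrite addrC; apply; rewrite -subr_eq0 addrK.
have {}ft : h^-1 *: ((f \o shift t) (h *: (1 : R)) - f t) @[h --> 0^'] --> d.
  have := cvg_comp _ _ shift0 ft.
  apply: cvg_trans; apply: near_eq_cvg; apply: nearW => h /=.
  by rewrite addrK [h%:A]mulr1 mulrC.
by apply: DeriveDef; [exact: cvgP ft|exact: cvg_lim ft].
Qed.

Lemma MVT_ge f df (a b m : R) : a <= b ->
  (forall x, x \in `]a, b[ -> is_derive x 1 f (df x)) ->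
  {within `[a, b], continuous f} ->
  (forall x, x \in `]a, b[ -> m <= df x) ->
  m * (b - a) <= f b - f a.
Proof.
rewrite le_eqVlt => /predU1P[-> _ _ _|ab fdf cf mdf].
  by rewrite !subrr mulr0.
have [c cab ->] := MVT ab fdf cf.
by rewrite ler_wpM2r ?mdf // subr_ge0 ltW.
Qed.

Lemma is_derive_bigsum (I : Type) (s : seq I) (f : I -> R -> R) (df : I -> R) (t : R) :
  (forall i, is_derive t 1 (f i) (df i)) ->
  is_derive t 1 (fun x => \sum_(i <- s) f i x) (\sum_(i <- s) df i).
Proof.
move=> fdf; elim: s => [|i s IH].
  rewrite big_nil (_ : (fun _ => _) = cst 0); last by apply/funext => x; rewrite big_nil.
  exact: is_derive_cst.
rewrite big_cons (_ : (fun _ => _) = f i + (fun x => \sum_(i <- s) f i x)).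
  exact: is_deriveD.
by apply/funext => x; rewrite big_cons.
Qed.

End Calculus.

(** * Balance laws and inequalities for one generation, at a fixed time *)

Section LevelIdentities.
Variables (R : realType) (alpha : R) (J : choiceType) (T : rooted_tree J).
Variables (N : nat) (x : J -> R).
Hypothesis TN : regular_tree T N.
Let b : R := 2 `^ alpha.

Definition level_mass (n : nat) : R := \sum_(j <- level T n) x j.

Definition level_energy (n : nat) : R := \sum_(j <- level T n) x j ^+ 2.

Definition level_corr (n : nat) : R :=
  \sum_(j <- level T n) \sum_(k <- children T j) x j * x k.

Definition level_flux (n : nat) : R :=
  \sum_(j <- level T n) \sum_(k <- children T j) x j ^+ 2 * x k.

Lemma coefE j : coef T alpha j = b ^+ gen T j.
Proof. by rewrite /coef powRrM powR_mulrn // powR_ge0. Qed.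

Lemma parent_root : parent T (Defs.root T) = None.
Proof.
case E: parent => [i|//]; have := gen_children ((treeP T i _).1 E).
by rewrite gen_root.
Qed.

Lemma outflowE n j : j \in level T n ->
  \sum_(k <- children T j) coef T alpha k * x j * x k =
  b ^+ n.+1 * \sum_(k <- children T j) x j * x k.
Proof.
move=> /gen_level jn; rewrite mulr_sumr; apply: eq_big_seq => k kj.
by rewrite coefE (gen_children kj) jn mulrA.
Qed.

Lemma dyadic_rhs_child n j k : j \in level T n -> k \in children T j ->
  dyadic_rhs T alpha x k =
  b ^+ n.+1 * x j ^+ 2 - b ^+ n.+2 * \sum_(l <- children T k) x k * x l.
Proof.
move=> jn kj; have kn : k \in level T n.+1.
  by rewrite -(gen_level jn) -(gen_children kj) mem_level.
rewrite /dyadic_rhs (@outflowE n.+1) // coefE (gen_children kj) (gen_level jn).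
by rewrite (treeP T j k).2.
Qed.

(** Each node of generation [n] feeds all of its [N] children with the same inflow, hence the factor
    [N]. *)
Lemma sum_dyadic_rhs n :
  \sum_(k <- level T n.+1) dyadic_rhs T alpha x k =
  N%:R * b ^+ n.+1 * level_energy n - b ^+ n.+2 * level_corr n.+1.
Proof.
rewrite /level_corr !big_levelS !mulr_sumr -sumrB.
apply: eq_big_seq => j jn.
rewrite (eq_big_seq _ (fun k kj => dyadic_rhs_child jn kj)) sumrB -!mulr_sumr.
by rewrite big_const_seq count_predT TN iter_addr_0 -mulr_natr; congr (_ - _); ring.
Qed.

(** The sum telescopes: the energy leaving a generation is exactly what enters the next one, and
    nothing enters the root, so only the outflow from generation [n] remains. *)
Lemma sum_energy_dyadic_rhs n :
  \sum_(i < n.+1) \sum_(j <- level T i) 2 * x j * dyadic_rhs T alpha x j =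
  - (2 * b ^+ n.+1 * level_flux n).
Proof.
have flux_corr j : \sum_(k <- children T j) x j ^+ 2 * x k =
    x j * \sum_(k <- children T j) x j * x k.
  by rewrite mulr_sumr; apply: eq_bigr => k _; rewrite mulrA expr2.
elim: n => [|n IH].
  rewrite big_ord1 /= big_seq1 /level_flux big_seq1 /dyadic_rhs parent_root /=.
  by rewrite (@outflowE 0) ?inE // flux_corr; ring.
rewrite big_ord_recr /= IH /level_flux !big_levelS !mulr_sumr -!sumrN -big_split /=.
apply: eq_big_seq => j jn; rewrite !mulr_sumr -!sumrN -big_split /=.
apply: eq_big_seq => k kj; rewrite (@dyadic_rhs_child n j k) // flux_corr; ring.
Qed.

(* AM-GM: [2 x y <= c x^2 y + y / c]. *)
Lemma level_corr_le (c : R) n : 0 < c -> (forall j, 0 <= x j) ->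
  2 * level_corr n <= c * level_flux n + c^-1 * level_mass n.+1.
Proof.
move=> c0 x0; rewrite /level_mass big_levelS !mulr_sumr -big_split /=.
apply: ler_sum => j _; rewrite !mulr_sumr -big_split /=; apply: ler_sum => k _.
have cc : c * c^-1 = 1 by rewrite divff ?gt_eqF.
have : 0 <= c * (x j - c^-1) ^+ 2 * x k.
  by rewrite mulr_ge0 // mulr_ge0 ?sqr_ge0 // ltW.
suff -> : c * (x j - c^-1) ^+ 2 * x k =
  c * (x j ^+ 2 * x k) + c^-1 * x k - 2 * (x j * x k) by rewrite subr_ge0.
transitivity (c * x j ^+ 2 * x k + (c * c^-1) * c^-1 * x k
  - 2 * (c * c^-1) * (x j * x k)); first ring.
rewrite cc; ring.
Qed.

(** Cauchy-Schwarz over the [N ^ n], that is [A ^+ 2], nodes of generation [n], obtained by summing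
    [2 x <= F / A + x ^+ 2 * (A / F)]. *)
Lemma level_mass_le (a F : R) n : 0 < a -> a ^+ 2 = N%:R -> 0 < F ->
  level_energy n <= F ^+ 2 -> level_mass n <= a ^+ n * F.
Proof.
move=> a0 aN F0 eF; set A := a ^+ n.
have A0 : 0 < A by rewrite exprn_gt0.
have : \sum_(j <- level T n) 2 * x j <=
    \sum_(j <- level T n) (F / A + x j ^+ 2 * (A / F)).
  apply: ler_sum => j _.
  have : 0 <= (x j * A - F) ^+ 2 / (A * F).
    by rewrite divr_ge0 ?sqr_ge0 ?mulr_ge0 ?ltW.
  suff -> : (x j * A - F) ^+ 2 / (A * F) =
    F / A + x j ^+ 2 * (A / F) - 2 * x j by rewrite subr_ge0.
  by field; rewrite ?gt_eqF.
rewrite -mulr_sumr big_split /= big_const_seq count_predT iter_addr_0 -mulr_suml.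
rewrite (@size_level _ T N) // -/(level_mass n) -/(level_energy n).
rewrite -[_ *+ (N ^ n)]mulr_natr natrX -aN -exprM mulnC exprM -/A => le2.
have : level_energy n * (A / F) <= F ^+ 2 * (A / F).
  by rewrite ler_wpM2r // divr_ge0 // ltW.
have -> : F ^+ 2 * (A / F) = A * F by field; rewrite gt_eqF.
have : F / A * A ^+ 2 = A * F by field; rewrite gt_eqF.
by lra.
Qed.

End LevelIdentities.

(** * Time evolution of the mass and energy of generations along a positive solution *)

Section Solution.
Variables (R : realType) (alpha : R) (J : choiceType) (T : rooted_tree J).
Variables (N : nat) (X0 : J -> R) (X : J -> R -> R).
Hypothesis TN : regular_tree T N.
Hypothesis Xsol : componentwise_solution T alpha X0 X.
Hypothesis X_ge0 : positive X.
Let b : R := 2 `^ alpha.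

Let b_gt0 : 0 < b. Proof. exact: powR_gt0. Qed.

Definition partial_energy (m : nat) (t : R) : R :=
  \sum_(i < m) level_energy T (X ^~ t) i.

Lemma is_derive_component j (t : R) : 0 < t ->
  is_derive t 1 (X j) (dyadic_rhs T alpha (X ^~ t) j).
Proof.
move=> t0; have [dX [_ dXd] dXE] := Xsol.2 j.
rewrite -dXE ?ltW //; apply: (@has_derivative_in_is_derive _ `[0, +oo[).
  have : \forall s \near t, 0 < s by exact: lt_nbhsr.
  by apply: filterS => s s0; rewrite /= in_itv /= andbT ltW.
by apply: dXd; rewrite /= in_itv /= andbT ltW.
Qed.

Lemma is_derive_level_mass n (t : R) : 0 < t ->
  is_derive t 1 (fun t => level_mass T (X ^~ t) n.+1)
    (N%:R * b ^+ n.+1 * level_energy T (X ^~ t) n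
     - b ^+ n.+2 * level_corr T (X ^~ t) n.+1).
Proof.
move=> t0; rewrite -(sum_dyadic_rhs alpha _ TN).
by apply: is_derive_bigsum => j; exact: is_derive_component.
Qed.

Lemma is_derive_partial_energy n (t : R) : 0 < t ->
  is_derive t 1 (partial_energy n.+1)
    (- (2 * b ^+ n.+1 * level_flux T (X ^~ t) n)).
Proof.
move=> t0; rewrite -sum_energy_dyadic_rhs.
apply: is_derive_bigsum => i; apply: is_derive_bigsum => j.
have Xj := is_derive_component j t0.
have := is_deriveX 2 Xj.
by rewrite expr1 /GRing.scale /=; exact.
Qed.

Lemma level_energy_ge0 n (t : R) : 0 <= level_energy T (X ^~ t) n.
Proof. by apply: sumr_ge0 => j _; exact: sqr_ge0. Qed.

Lemma level_energy_le_partial n (t : R) :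
  level_energy T (X ^~ t) n <= partial_energy n.+1 t.
Proof.
by rewrite /partial_energy big_ord_recr /= lerDr sumr_ge0 // => i _;
   exact: level_energy_ge0.
Qed.

Lemma level_mass_ge0 n (t : R) : 0 <= t -> 0 <= level_mass T (X ^~ t) n.
Proof. by move=> t0; apply: sumr_ge0 => j _; exact: X_ge0. Qed.

Lemma level_flux_ge0 n (t : R) : 0 <= t -> 0 <= level_flux T (X ^~ t) n.
Proof.
move=> t0; apply: sumr_ge0 => j _; apply: sumr_ge0 => k _.
by rewrite mulr_ge0 ?sqr_ge0 ?X_ge0.
Qed.

Lemma partial_energy_continuous m :
  {within `[0, +oo[, continuous (partial_energy m)}.
Proof.
apply/subspace_continuousP => t t0.
have Xt j : X j s @[s --> within `[0, +oo[ (nbhs t)] --> X j t.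
  have [dX [_ dXd] _] := Xsol.2 j.
  exact: has_derivative_in_continuous (dXd t t0).
apply: cvg_big => [|i _]; first exact: add_continuous.
apply: cvg_big => [|j _]; first exact: add_continuous.
exact: (cvgM (Xt j) (Xt j)).
Qed.

(** Positivity makes the flux nonnegative. The case [s = 0] is needed to compare with the initial
    energy; there only continuity at the endpoint is used, the derivative being taken at positive
    times. *)
Lemma partial_energy_nincr m (s t : R) : 0 <= s -> s <= t ->
  partial_energy m t <= partial_energy m s.
Proof.
move=> s0 st; case: m => [|n]; first by rewrite /partial_energy !big_ord0.
have e_cont : {within `[s, t], continuous (partial_energy n.+1)}.
  apply: continuous_subspaceW (@partial_energy_continuous n.+1) => x /=.
  by rewrite !in_itv /= andbT => /andP[/(le_trans s0)].
have : 0 * (t - s) <= - partial_energy n.+1 t - - partial_energy n.+1 s.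
  apply: (@MVT_ge _ (- partial_energy n.+1)
    (fun x => - - (2 * b ^+ n.+1 * level_flux T (X ^~ x) n))) => //.
  - move=> x; rewrite in_itv /= => /andP[sx _]; apply: is_deriveN.
    by apply: is_derive_partial_energy; exact: le_lt_trans sx.
  - by move=> x; apply: continuousN; exact: e_cont.
  - move=> x; rewrite in_itv /= => /andP[sx _].
    rewrite opprK !mulr_ge0 ?exprn_ge0 ?level_flux_ge0 // ?ltW //.
    exact: le_lt_trans sx.
by lra.
Qed.

Variables (a q : R).
Hypotheses (a_gt0 : 0 < a) (aN : a ^+ 2 = N%:R).
Hypotheses (q_gt0 : 0 < q) (q_lt1 : q < 1) (qa : q ^+ 2 * b = a).

Let N_gt0 : 0 < N%:R :> R. Proof. by rewrite -aN exprn_gt0. Qed.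
Let N_ge1 : 1 <= N%:R :> R. Proof. by rewrite ler1n -(ltr0n R). Qed.
Let bX_gt0 n : 0 < b ^+ n. Proof. exact: exprn_gt0. Qed.
Let qX_gt0 n : 0 < q ^+ n. Proof. exact: exprn_gt0. Qed.
Let qX_le1 n : q ^+ n <= 1. Proof. by rewrite exprn_ile1 ?ltW. Qed.

(** Relative to [b ^+ n], the Cauchy-Schwarz factor carries [q ^+ n] twice: one copy is absorbed by
    the weight of the energy in [lyapunov], the other makes the errors summable. *)
Lemma aXE n : a ^+ n = q ^+ n * q ^+ n * b ^+ n.
Proof. by rewrite -qa exprMn -exprM mulnC exprM expr2. Qed.

(** * Lyapunov functionals and the decay estimate between two times *)

Section Lyapunov.
Variables (mu F s : R).
Hypotheses (mu_gt0 : 0 < mu) (F_gt0 : 0 < F) (s_gt0 : 0 < s).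
Hypothesis energy_s : forall m, partial_energy m s <= F ^+ 2.

(** The first term is normalized so that its derivative contains [level_energy] with coefficient 1.
    The second increases in time, and its growth pays for the loss through [level_corr]. *)
Definition lyapunov (n : nat) (t : R) : R :=
  (N%:R * b ^+ n.+1)^-1 * level_mass T (X ^~ t) n.+1
  - b / (4 * N%:R) * mu * q ^+ n * partial_energy n.+2 t.

Definition lyapunov_derivative (n : nat) (t : R) : R :=
  (N%:R * b ^+ n.+1)^-1 * (N%:R * b ^+ n.+1 * level_energy T (X ^~ t) n
     - b ^+ n.+2 * level_corr T (X ^~ t) n.+1)
  - b / (4 * N%:R) * mu * q ^+ n *
    - (2 * b ^+ n.+2 * level_flux T (X ^~ t) n.+1).

Lemma is_derive_lyapunov n (t : R) : 0 < t ->
  is_derive t 1 (lyapunov n) (lyapunov_derivative n t).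
Proof.
move=> t0; apply: is_deriveB.
  exact: (is_deriveZ _ (is_derive_level_mass n t0)).
exact: (is_deriveZ _ (is_derive_partial_energy n.+1 t0)).
Qed.

Lemma level_mass_le_after n (t : R) : s <= t ->
  level_mass T (X ^~ t) n <= a ^+ n * F.
Proof.
move=> st; apply: (level_mass_le TN) => //.
apply: le_trans (energy_s n.+1); apply: le_trans (partial_energy_nincr _ _ st).
  exact: level_energy_le_partial.
exact: ltW.
Qed.

Lemma lyapunov_derivative_ge n (t : R) : s <= t ->
  level_energy T (X ^~ t) n - b * F / mu * q ^+ n <= lyapunov_derivative n t.
Proof.
move=> st; have t0 : 0 <= t by exact: le_trans (ltW s_gt0) st.
(* With this AM-GM parameter the flux term cancels exactly against the one produced by the weight
   [b / (4 * N%:R) * mu * q ^+ n]. *)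
pose c := mu * q ^+ n * b ^+ n.+2.
have c0 : 0 < c by rewrite /c mulr_gt0 // mulr_gt0.
have := @level_corr_le _ _ T (X ^~ t) c n.+1 c0 (fun j => X_ge0 j t0).
set S := level_energy _ _ _; set P := level_corr _ _ _.
set Q := level_flux _ _ _; set Y := level_mass _ _ _ => PQY.
have Yle : c^-1 * Y <= F / mu * q ^+ n.
  rewrite ler_pdivrMl //; apply: le_trans (level_mass_le_after _ st) _.
  rewrite aXE (_ : c * _ = F * q ^+ n * q ^+ n * b ^+ n.+2); last first.
    by rewrite /c; field; rewrite gt_eqF.
  rewrite [leLHS](_ : _ = (q ^+ 4 * (F * q ^+ n * q ^+ n * b ^+ n.+2))).
    by rewrite ler_piMl // ltW // mulr_gt0 // mulr_gt0 // mulr_gt0.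
  by rewrite !exprS expr0; ring.
have -> : lyapunov_derivative n t = S - b / (2 * N%:R) * (2 * P - c * Q).
  rewrite /lyapunov_derivative -/S -/P -/Q /c [b ^+ n.+2]exprS.
  by field; rewrite !gt_eqF.
rewrite lerD2l lerN2 (_ : b * F / mu * _ = b * (F / mu * q ^+ n)); last by rewrite !mulrA.
apply: le_trans (_ : b / (2 * N%:R) * (F / mu * q ^+ n) <= _).
  by rewrite ler_wpM2l ?divr_ge0 ?mulr_ge0 ?ler0n ?(ltW b_gt0) //; lra.
rewrite ler_wpM2r //; first by rewrite ltW // mulr_gt0 // divr_gt0.
by rewrite ler_pdivrMr ?mulr_gt0 // ler_peMr ?(ltW b_gt0) //; have := N_ge1; lra.
Qed.

(** The mass at time [s] and the energy at time [t] enter with a favourable sign and are dropped;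
    the two remaining terms are bounded by the energy bound at [s]. *)
Lemma lyapunov_increment_le n (t : R) : s <= t ->
  lyapunov n t - lyapunov n s <= (F + b * mu * F ^+ 2) * q ^+ n.
Proof.
move=> st; have t0 : 0 <= t by exact: le_trans (ltW s_gt0) st.
have M0 : 0 < N%:R * b ^+ n.+1 by rewrite mulr_gt0.
have Yt : (N%:R * b ^+ n.+1)^-1 * level_mass T (X ^~ t) n.+1 <= F * q ^+ n.
  rewrite ler_pdivrMl //; apply: le_trans (level_mass_le_after _ st) _.
  rewrite aXE [leLHS](_ : _ = q ^+ n.+2 * (b ^+ n.+1 * (F * q ^+ n))); last first.
    by rewrite !exprS; ring.
  rewrite -[leRHS]mulrA ler_wpM2r ?(le_trans (qX_le1 _)) // ltW // mulr_gt0 //.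
  exact: mulr_gt0.
have Ys : 0 <= (N%:R * b ^+ n.+1)^-1 * level_mass T (X ^~ s) n.+1.
  by rewrite mulr_ge0 ?invr_ge0 ?level_mass_ge0 // ltW.
set c := b / (4 * N%:R) * mu * q ^+ n.
have c0 : 0 <= c.
  by rewrite ltW // /c mulr_gt0 // mulr_gt0 // divr_gt0 // mulr_gt0.
have ct : 0 <= c * partial_energy n.+2 t.
  by rewrite mulr_ge0 // sumr_ge0 // => i _; exact: level_energy_ge0.
have cs : c * partial_energy n.+2 s <= b * mu * F ^+ 2 * q ^+ n.
  apply: le_trans (ler_wpM2l c0 (energy_s _)) _.
  rewrite [leRHS](_ : _ = (b * mu * q ^+ n) * F ^+ 2); last by ring.
  rewrite ler_wpM2r ?sqr_ge0 // /c ler_wpM2r ?(ltW (qX_gt0 n)) //.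
  rewrite ler_wpM2r ?(ltW mu_gt0) //.
  by rewrite ltW // ltr_pdivrMr ?mulr_gt0 // ltr_pMr //; have := N_ge1; lra.
rewrite /lyapunov -/c mulrDl; lra.
Qed.

(** The derivative bounds are summed over [n < m] and integrated from [s] to [t]. The geometric
    series makes the result uniform in [m]. *)
Lemma partial_energy_decay m (t : R) : s <= t ->
  (t - s) * partial_energy m t <=
  (1 + b) / (1 - q) * (F + mu * F ^+ 2 + (t - s) * (F / mu)).
Proof.
move=> st; have t0 : 0 <= t by exact: le_trans (ltW s_gt0) st.
have geom : \sum_(n < m) q ^+ n <= (1 - q)^-1.
  rewrite -[leRHS]mul1r ler_pdivlMr ?subr_gt0 //.
  by have := subrX1 q m; have := ltW (qX_gt0 m); lra.
have mvt : (partial_energy m t - b * F / mu * \sum_(n < m) q ^+ n) * (t - s) <=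
    \sum_(n < m) lyapunov n t - \sum_(n < m) lyapunov n s.
  have der (x : R) : s <= x -> is_derive x 1 (fun x => \sum_(n < m) lyapunov n x)
      (\sum_(n < m) lyapunov_derivative n x).
    move=> sx; apply: is_derive_bigsum => n; apply: is_derive_lyapunov.
    exact: lt_le_trans sx.
  apply: (@MVT_ge _ (fun t => \sum_(n < m) lyapunov n t)
    (fun t => \sum_(n < m) lyapunov_derivative n t)) => //.
  - by move=> x; rewrite in_itv /= => /andP[/ltW sx _]; exact: der.
  - apply: derivable_within_continuous => x; rewrite in_itv /= => /andP[sx _].
    exact: (@ex_derive _ _ _ _ _ _ _ (der x sx)).
  - move=> x; rewrite in_itv /= => /andP[/ltW sx /ltW xt].
    (* By monotonicity the energy at the intermediate time [x] is at least that at [t], which gives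
       the constant lower bound on the derivative. *)
    have := partial_energy_nincr m (le_trans (ltW s_gt0) sx) xt.
    rewrite mulr_sumr /partial_energy => ex.
    apply: le_trans (lerB ex (lexx _)) _; rewrite -sumrB.
    by apply: ler_sum => n _; exact: lyapunov_derivative_ge.
have inc : \sum_(n < m) lyapunov n t - \sum_(n < m) lyapunov n s <=
    (F + b * mu * F ^+ 2) * \sum_(n < m) q ^+ n.
  rewrite -sumrB mulr_sumr; apply: ler_sum => n _; exact: lyapunov_increment_le.
move: mvt inc geom; set g := \sum_(n < m) q ^+ n => mvt inc geom.
have fm0 : 0 < F / mu by rewrite divr_gt0.
have mF0 : 0 < mu * F ^+ 2 by rewrite mulr_gt0 // exprn_gt0.
have g0 : 0 <= g by apply: sumr_ge0 => n _; exact: ltW.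
set B := F + mu * F ^+ 2 + (t - s) * (F / mu).
have tsF : 0 <= (t - s) * (F / mu) by rewrite mulr_ge0 ?subr_ge0 ?(ltW fm0).
apply: le_trans (_ : (1 + b) * B * g <= _); last first.
  rewrite [leRHS]mulrAC ler_wpM2l // mulr_ge0 //; first by have := b_gt0; lra.
  by rewrite /B addr_ge0 // addr_ge0 // ltW.
apply: le_trans (_ : (F + b * mu * F ^+ 2 + (t - s) * (b * F / mu)) * g <= _).
  by lra.
rewrite ler_wpM2r // /B -subr_ge0.
rewrite (_ : _ - _ = b * F + mu * F ^+ 2 + (t - s) * (F / mu)); last by ring.
by rewrite !addr_ge0 // ltW // mulr_gt0.
Qed.

End Lyapunov.

End Solution.

(** * Choice of constants and propagation of the bound by doubling times *)

Lemma lt_alpha_tilde_sqrt (R : realType) (alpha : R) (N : nat) : (1 <= N)%N ->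
  alpha_tilde R N < alpha -> Num.sqrt N%:R < 2 `^ alpha.
Proof.
move=> N1; have N0 : 0 < N%:R :> R by rewrite ltr0n.
have ln2 : 0 < ln 2 :> R by rewrite ln_gt0 // ltr1n.
have b0 : 0 < 2 `^ alpha :> R by exact: powR_gt0.
rewrite -(@ltr_pM2l _ (2 * ln 2)) ?mulr_gt0 // /alpha_tilde /log2.
have -> : 2 * ln 2 * (2^-1 * (ln N%:R / ln 2)) = ln N%:R :> R by field; rewrite gt_eqF.
have -> : 2 * ln 2 * alpha = ln ((2 `^ alpha) ^+ 2) :> R.
  by rewrite lnXn // ln_powR; ring.
rewrite ltr_ln ?posrE ?exprn_gt0 // => Nb.
by rewrite -(@ltr_pXn2r _ 2) ?nnegrE ?sqrtr_ge0 ?(ltW b0) // sqr_sqrtr ?(ltW N0).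
Qed.

Lemma partial_energy0_le (R : realType) (alpha : R) (J : choiceType)
    (T : rooted_tree J) (X0 : J -> R) (X : J -> R -> R) m :
  l2_solution T alpha X0 X -> partial_energy T X m 0 <= l2norm X0 ^+ 2.
Proof.
move=> [[X0E _] /(_ 0 (lexx _))]; rewrite /in_l2.
have -> : X ^~ 0 = X0 by apply/funext.
move=> fin; have ge0 : (0 <= sqnorm X0)%E.
  by apply: esum_ge0 => j _; rewrite lee_fin sqr_ge0.
rewrite /l2norm sqr_sqrtr ?fine_ge0 //.
have : (sqnorm (X ^~ 0%R) <= (fine (sqnorm X0))%:E)%E.
  have -> : X ^~ 0 = X0 by apply/funext.
  by rewrite fineK // ge0_fin_numE.
by move/(sqnorm_leP T); exact.
Qed.

(** The left side is [D / t * (2 * K + 32 * K ^+ 2) + D ^+ 2 / (8 * t)], the right side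
    [D ^+ 2 / (2 * t)]. The choice of [t / (32 * K)] makes the quadratic term a quarter of the right
    side, and the lower bound on [D] makes the linear terms at most half of it. *)
Lemma energy_decay_const (R : realType) (K D t : R) : 0 < K -> 0 < t ->
  8 * K + 128 * K ^+ 2 <= D ->
  K * (2 * D / t + t / (32 * K) * (2 * D / t) ^+ 2
       + t / 2 * (2 * D / t / (t / (32 * K)))) <= t / 2 * (D ^+ 2 / t ^+ 2).
Proof.
move=> K0 t0 KD.
have D0 : 0 < D by apply: lt_le_trans KD; rewrite addr_gt0 // mulr_gt0 // exprn_gt0.
rewrite -subr_ge0.
have -> : t / 2 * (D ^+ 2 / t ^+ 2) - K * (2 * D / t + t / (32 * K) * (2 * D / t) ^+ 2
       + t / 2 * (2 * D / t / (t / (32 * K)))) =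
  D / t * (8^-1 * 3 * D - 2 * K - 32 * K ^+ 2).
  by field; rewrite !gt_eqF.
rewrite mulr_ge0 ?divr_ge0 ?(ltW D0) ?(ltW t0) //.
have : 0 < K ^+ 2 by rewrite exprn_gt0.
lra.
Qed.

Unset Implicit Arguments.

Theorem theorem2p1 (R : realType) (alpha : R) (N : nat)
    (alpha_gt0 : 0 < alpha) (N_ge1 : (1 <= N)%N)
    (alpha_tilde_lt : alpha_tilde R N < alpha) :
  forall r : R, exists2 C : R, 0 < C &
    forall (J : choiceType) (T : rooted_tree J) (X0 : J -> R) (X : J -> R -> R),
      regular_tree T N ->
      l2_solution T alpha X0 X ->
      positive X ->
      l2norm X0 = r ->
      forall t : R, 0 < t -> (energy X t < (C / t ^+ 2)%:E)%E.
Proof.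
move=> r; set b : R := 2 `^ alpha.
have b0 : 0 < b by exact: powR_gt0.
have N0 : 0 < N%:R :> R by rewrite ltr0n.
pose a : R := Num.sqrt N%:R; pose q : R := Num.sqrt (a / b).
have a0 : 0 < a by rewrite sqrtr_gt0.
have aN : a ^+ 2 = N%:R by rewrite sqr_sqrtr // ltW.
have q0 : 0 < q by rewrite sqrtr_gt0 divr_gt0.
have q2 : q ^+ 2 = a / b by rewrite sqr_sqrtr // ltW // divr_gt0.
have q1 : q < 1.
  rewrite -(@ltr_pXn2r _ 2) ?nnegrE ?(ltW q0) // q2 expr1n ltr_pdivrMr // mul1r.
  exact: lt_alpha_tilde_sqrt.
have qa : q ^+ 2 * b = a by rewrite q2 divfK // gt_eqF.
pose K := (1 + b) / (1 - q).
have K0 : 0 < K by rewrite divr_gt0 ?subr_gt0 // addr_gt0.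
(* The terms in [K] close the induction step; [|r|] settles the times [t <= 1], where the energy is
   at most [r ^+ 2]. *)
pose D := 8 * K + 128 * K ^+ 2 + `|r|.
have KK0 : 0 < 8 * K + 128 * K ^+ 2.
  by rewrite addr_gt0 // mulr_gt0 // exprn_gt0.
have D0 : 0 < D by rewrite ltr_wpDr.
(* The added 1 turns the bound by [D ^+ 2 / t ^+ 2] into a strict one. *)
exists (D ^+ 2 + 1); first by rewrite addr_gt0 // exprn_gt0.
move=> J T X0 X TN Xl2 Xge0 X0r t t0.
have decay n : forall t : R, 0 < t -> t <= 2 ^+ n ->
    forall m, partial_energy T X m t <= D ^+ 2 / t ^+ 2.
  elim: n => {t t0} [|n IH] t t0 tn m.
    apply: le_trans (partial_energy_nincr Xl2.1 Xge0 m (lexx 0) (ltW t0)) _.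
    apply: le_trans (partial_energy0_le m Xl2) _; rewrite X0r.
    rewrite ler_pdivlMr ?exprn_gt0 //.
    rewrite -[leRHS]mulr1 ler_pM ?sqr_ge0 //; last by rewrite exprn_ile1 // ltW.
    rewrite -[r ^+ 2]real_normK ?num_real // ler_pXn2r ?nnegrE ?(ltW D0) //.
    by rewrite /D lerDr ltW.
  have s0 : 0 < t / 2 by rewrite divr_gt0.
  have F0 : 0 < 2 * D / t by rewrite divr_gt0 // mulr_gt0.
  have mu0 : 0 < t / (32 * K) by rewrite divr_gt0 // mulr_gt0.
  (* The induction hypothesis at [t / 2], rewritten as the energy bound with [F = 2 * D / t]. *)
  have es k : partial_energy T X k (t / 2) <= (2 * D / t) ^+ 2.
    have -> : (2 * D / t) ^+ 2 = D ^+ 2 / (t / 2) ^+ 2 by field; rewrite gt_eqF.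
    by apply: IH => //; rewrite ler_pdivrMr // -exprSr.
  have st : t / 2 <= t by lra.
  have := partial_energy_decay TN Xl2.1 Xge0 a0 aN q0 q1 qa mu0 F0 s0 es m st.
  rewrite -/b -/K (_ : t - t / 2 = t / 2); last by field.
  move=> /le_trans; rewrite -(@ler_pM2l _ (t / 2)) //; apply.
  by apply: energy_decay_const => //; rewrite lerDl.
have : (energy X t <= (D ^+ 2 / t ^+ 2)%:E)%E.
  apply/(sqnorm_leP T); apply: (decay (Num.bound t)) => //.
  apply: le_trans (ltW (archi_boundP (ltW t0))) _.
  by rewrite -natrX ler_nat ltnW // ltn_expl.
move=> /le_lt_trans; apply.
by rewrite lte_fin ltr_pM2r ?invr_gt0 ?exprn_gt0 // ltrDl.
Qed.
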